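(* Let $X$ be a weakly almost square Banach space and let $Y\subseteq X$ be a closed subspace. If $X/Y$ has the Schur property, then $Y$ is weakly almost square.
   Context: All Banach spaces are real and non-zero (in particular $Y\neq\{0\}$). $B_X$ and $S_X$ denote the closed unit ball and the unit sphere of $X$. A Banach space $X$ is weakly almost square (WASQ) if for every $x\in S_X$ there exists a sequence $\{y_n\}$ in $B_X$ such that $\|x\pm y_n\|\to 1$, $\|y_n\|\to 1$ and $y_n\to 0$ weakly. A Banach space has the Schur property if every weakly convergent sequence in it is norm convergent. *)

(* Defs.v *)
From HB Require Import structures.
From mathcomp Require Import all_boot all_order all_algebra.
From mathcomp Require Import generic_quotient ring_quotient.
From mathcomp Require Import all_classical all_reals all_analysis.

Set Implicit Arguments.
Unset Strict Implicit.
Unset Printing Implicit Defensive.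

Import Order.TTheory GRing.Theory Num.Theory.
Import numFieldNormedType.Exports.

Local Open Scope classical_set_scope.
Local Open Scope ring_scope.

(* Completeness of the space plays no role in these properties, so they are
   stated for arbitrary real normed spaces. *)
Section WeaklyAlmostSquare.
Context {R : realType}.

Definition weakly_cvg (V : normedModType R) (u : V^nat) (l : V) : Prop :=
  forall f : {linear V -> R^o}, continuous f -> f (u n) @[n --> \oo] --> f l.

Definition WASQ (V : normedModType R) : Prop :=
  forall x : V, `|x| = 1 -> exists y : V^nat,
    [/\ forall n, `|y n| <= 1,
        (`|x + y n| @[n --> \oo] --> (1 : R)) /\
        (`|x - y n| @[n --> \oo] --> (1 : R)),
        `|y n| @[n --> \oo] --> (1 : R) &
        weakly_cvg y 0].

Definition schur_property (V : normedModType R) : Prop :=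
  forall u : V^nat, (exists l, weakly_cvg u l) -> cvgn u.

End WeaklyAlmostSquare.

Record closedSubspace (R : realType) (X : normedModType R) := ClosedSubspace {
  cs_pred :> {pred X};
  cs_submod : submod_closed cs_pred;
  cs_closed : closed [set x | x \in cs_pred]
}.

HB.instance Definition _ (R : realType) (X : normedModType R)
    (Y : closedSubspace X) :=
  GRing.isSubmodClosed.Build R X (cs_pred Y) (cs_submod Y).

Section Subspace.
Context {R : realType} {X : normedModType R}.

Record sub_space (Y : closedSubspace X) : Type :=
  SubSpace { sub_val : X; sub_valP : sub_val \in Y }.

Variable Y : closedSubspace X.
Local Notation S := (sub_space Y).

HB.instance Definition _ := [isSub for @sub_val Y].
HB.instance Definition _ := [Choice of S by <:].
HB.instance Definition _ := [SubChoice_isSubLmodule of S by <:].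

Let nrm (x : S) : R := `|val x|.

Let nrmD x y : nrm (x + y) <= nrm x + nrm y.
Proof. by rewrite /nrm raddfD ler_normD. Qed.

Let nrmZ (a : R) x : nrm (a *: x) = `|a| * nrm x.
Proof. by rewrite /nrm linearZ/= normrZ. Qed.

Let nrm0 x : nrm x = 0 -> x = 0.
Proof. by move=> /normr0_eq0 x0; apply/val_inj; rewrite x0 raddf0. Qed.

HB.instance Definition _ := Lmodule_isNormed.Build R S nrmD nrmZ nrm0.

Lemma sub_normE (x : S) : `|x| = `|val x|.
Proof. by []. Qed.

End Subspace.

Section Quotient.
Local Open Scope quotient_scope.
Context {R : realType} {X : normedModType R}.

Definition quot_space (Y : closedSubspace X) : Type :=
  Quotient.quot (cs_pred Y : zmodClosed X).

Variable Y : closedSubspace X.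
Local Notation Q := (quot_space Y).

HB.instance Definition _ := Choice.on Q.
HB.instance Definition _ := GRing.Zmodule.on Q.
HB.instance Definition _ := EqQuotient.on Q.
HB.instance Definition _ := ZmodQuotient.on Q.

Definition quot_proj (x : X) : Q := \pi_Q x.

Lemma quot_projP x y : quot_proj x = quot_proj y <-> x - y \in Y.
Proof.
split => [xy|xy]; last by apply/eqP; rewrite /quot_proj -Quotient.idealrBE.
by rewrite Quotient.idealrBE; apply/eqP.
Qed.

Lemma quot_proj_surj q : exists x, quot_proj x = q.
Proof. by exists (repr q); rewrite /quot_proj reprK. Qed.

Let projD x y : quot_proj (x + y) = quot_proj x + quot_proj y.
Proof. by rewrite /quot_proj -pi_addr. Qed.

Let proj_eq x y : x - y \in Y -> quot_proj x = quot_proj y.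
Proof. by move/quot_projP. Qed.

Let scale (a : R) (q : Q) : Q := quot_proj (a *: repr q).

Let scaleE a x : scale a (quot_proj x) = quot_proj (a *: x).
Proof.
apply: proj_eq; rewrite -scalerBr; apply: rpredZ.
by apply/quot_projP; rewrite /quot_proj reprK.
Qed.

Let scaleA a b q : scale a (scale b q) = scale (a * b) q.
Proof. by have [x <-] := quot_proj_surj q; rewrite !scaleE scalerA. Qed.

Let scale1 : left_id 1 scale.
Proof. by move=> q; have [x <-] := quot_proj_surj q; rewrite scaleE scale1r. Qed.

Let scaleDr : right_distributive scale +%R.
Proof.
move=> a p q; have [x <-] := quot_proj_surj p; have [y <-] := quot_proj_surj q.
by rewrite -projD !scaleE scalerDr projD.
Qed.

Let scaleDl q : {morph scale^~ q : a b / a + b}.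
Proof.
by move=> a b; have [x <-] := quot_proj_surj q; rewrite !scaleE scalerDl projD.
Qed.

HB.instance Definition _ :=
  GRing.Zmodule_isLmodule.Build R Q scaleA scale1 scaleDr scaleDl.

Lemma quot_proj_is_linear : linear quot_proj.
Proof. by move=> a x y; rewrite projD -scaleE. Qed.

HB.instance Definition _ :=
  GRing.isLinear.Build R X Q *:%R quot_proj quot_proj_is_linear.

Definition quot_norm (q : Q) : R :=
  inf (Num.norm @` [set x | quot_proj x = q]).

Let coset_norms_has_inf q :
  has_inf (Num.norm @` [set x | quot_proj x = q]).
Proof.
split; first by have [x xq] := quot_proj_surj q; exists `|x|, x.
by exists 0 => _ [x _ <-].
Qed.

Lemma quot_norm_le x : quot_norm (quot_proj x) <= `|x|.
Proof.
by apply: ge_inf; [exact: (coset_norms_has_inf _).2|exists x].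
Qed.

Lemma quot_norm_lt q r :
  quot_norm q < r -> exists2 x, quot_proj x = q & `|x| < r.
Proof.
by move/(inf_lt (coset_norms_has_inf q).1) => [_ [x xq <-] xr]; exists x.
Qed.

Let quot_norm_ge0 q : 0 <= quot_norm q.
Proof.
by apply: lb_le_inf; [exact: (coset_norms_has_inf q).1|move=> _ [x _ <-]].
Qed.

Let quot_normD p q : quot_norm (p + q) <= quot_norm p + quot_norm q.
Proof.
apply/ler_addgt0Pl => e e0.
have e20 : 0 < e / 2 by rewrite divr_gt0.
have [x <- xe] : exists2 x, quot_proj x = p & `|x| < quot_norm p + e / 2.
  by apply: quot_norm_lt; rewrite ltrDl.
have [y <- ye] : exists2 y, quot_proj y = q & `|y| < quot_norm q + e / 2.
  by apply: quot_norm_lt; rewrite ltrDl.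
rewrite -projD (le_trans (quot_norm_le _))// (le_trans (ler_normD _ _))//.
by rewrite (le_trans (lerD (ltW xe) (ltW ye)))// {3}(splitr e) addrACA addrC.
Qed.

Let quot_norm0 q : quot_norm q = 0 -> q = 0.
Proof.
have [x <-] := quot_proj_surj q => x0.
rewrite -[0](raddf0 quot_proj); apply/quot_projP; rewrite subr0.
apply: (@cs_closed _ _ Y) => A /nbhs_ballP[e /= e0 eA].
have [z zx ze] : exists2 z, quot_proj z = quot_proj x & `|z| < e.
  by apply: quot_norm_lt; rewrite x0.
exists (x - z); split; first by apply/quot_projP.
by apply: eA; rewrite -ball_normE /ball_/= opprB addrC subrK.
Qed.

Let quot_normZ_le a q : quot_norm (a *: q) <= `|a| * quot_norm q.
Proof.
apply/ler_addgt0Pl => e e0.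
have a1 : 0 < `|a| + 1 by rewrite ltr_wpDl.
have [x <- xe] : exists2 x, quot_proj x = q & `|x| < quot_norm q + e / (`|a| + 1).
  by apply: quot_norm_lt; rewrite ltrDl divr_gt0.
rewrite -linearZ (le_trans (quot_norm_le _))// normrZ.
rewrite (le_trans (ler_wpM2l (normr_ge0 a) (ltW xe)))// mulrDr addrC lerD2r.
by rewrite mulrCA ger_pMr// ler_pdivrMr// mul1r lerDl.
Qed.

Let quot_normZ a q : quot_norm (a *: q) = `|a| * quot_norm q.
Proof.
apply/eqP; rewrite eq_le quot_normZ_le/=.
have [->|a0] := eqVneq a 0; first by rewrite normr0 mul0r.
rewrite -ler_pdivlMl ?normr_gt0//.
by have := quot_normZ_le a^-1 (a *: q); rewrite scalerA mulVf// scale1r normfV.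
Qed.

HB.instance Definition _ :=
  Lmodule_isNormed.Build R Q quot_normD quot_normZ quot_norm0.

Lemma quot_normE (q : Q) :
  `|q| = inf (Num.norm @` [set x | quot_proj x = q]).
Proof. by []. Qed.

End Quotient.

Arguments quot_proj {R X} Y x.

(* Main.v *)
(* For [x] in the unit sphere of [Y], take an almost square sequence [y] for [x]
   in [X]. Its image in [X/Y] is weakly null, hence norm null by the Schur
   property, so there are [w n] in [X] with [w n --> 0] and [y n - w n] in [Y].
   Dividing [y n - w n] by [1 + |w n|] gives vectors [t n] in the unit ball of
   [Y] with [t n - y n --> 0] in norm, so all the norm conditions pass from [y]
   to [t]. Weak nullity in [Y] follows because functionals on [Y] extend to [X]
   by Hahn-Banach, obtained by applying Zorn's lemma to the graphs of partial
   linear functionals dominated by a sublinear [p]. *)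

Require Import Defs.
From HB Require Import structures.
From mathcomp Require Import all_boot all_order all_algebra.
From mathcomp Require Import all_classical all_reals all_analysis.

Set Implicit Arguments.
Unset Strict Implicit.
Unset Printing Implicit Defensive.

Import Order.TTheory GRing.Theory Num.Theory.
Import numFieldNormedType.Exports.
Local Open Scope classical_set_scope.
Local Open Scope ring_scope.

(** * Hahn-Banach extension under a sublinear bound *)

Section HahnBanach.
Context {R : realType} {V : lmodType R} (p : V -> R).
Hypothesis pD : forall x y, p (x + y) <= p x + p y.
Hypothesis pZ : forall a x, 0 < a -> p (a *: x) = a * p x.

(* Domination makes such a graph single-valued: if [(0, r)] belongs to it then
   so does [(0, - r)], and [p 0 = 0]. *)
Definition dominated_linear_graph (G : set (V * R^o)) : Prop :=
  (forall a u v, G u -> G v -> G (a *: u + v)) /\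
  (forall u, G u -> u.2 <= p u.1).

Lemma dominated_linear_graph_fun G x r s : dominated_linear_graph G ->
  G (x, r) -> G (x, s) -> r = s.
Proof.
move=> [Glin Gp].
have p0 : p 0 = 0.
  (* Positive homogeneity with factor 2 gives [2 * p 0 = p 0]. *)
  by apply: (addrI (p 0)); rewrite addr0 -mulr2n -mulr_natl -pZ ?scaler0.
have le_rs r1 s1 : G (x, r1) -> G (x, s1) -> r1 <= s1.
  move=> Gr Gs; have /Gp := Glin (-1) _ _ Gs Gr.
  by rewrite /= !scaleN1r addNr p0 addrC subr_le0.
by move=> Gr Gs; apply/eqP; rewrite eq_le !le_rs.
Qed.

(** The value [r] at [v] must lie above every [u.2 - p (u.1 - v)] and below every
    [p (u.1 + v) - u.2], for [u] in [G]. Subadditivity puts each lower bound below each upper one,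
    so the supremum of the lower bounds serves. *)
Lemma dominated_linear_graph_extend G v : G 0 -> dominated_linear_graph G ->
  exists G', [/\ dominated_linear_graph G', G `<=` G' & exists r, G' (v, r)].
Proof.
move=> G0 [Glin Gp].
pose A := [set u.2 - p (u.1 - v) | u in G].
have Aub u : G u -> ubound A (p (u.1 + v) - u.2).
  move=> Gu _ [w Gw <-]; rewrite lerBrDr -addrAC lerBlDr [leRHS]addrC.
  have := Glin 1 _ _ Gw Gu; rewrite scale1r => /Gp /=/le_trans; apply.
  rewrite -[X in p X](_ : (w.1 - v) + (u.1 + v) = _); first exact: pD.
  by rewrite addrACA [- v + v]addrC subrr addr0.
have A_sup : has_sup A.
  by split; [exists (0 - p (0 - v)), 0|exists (p (0 + v) - 0); exact: (Aub 0)].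
pose r : R := sup A.
have r_ge u : G u -> u.2 - p (u.1 - v) <= r.
  by move=> Gu; apply: ub_le_sup; [exact: A_sup.2|exists u].
have r_le u : G u -> r <= p (u.1 + v) - u.2.
  by move=> Gu; apply: ge_sup; [exact: A_sup.1|exact: Aub].
have GZ a u : G u -> G (a *: u).
  by move=> Gu; rewrite -[_ *: _]addr0; exact: Glin.
exists [set w | exists u (a : R), G u /\ w = u + a *: ((v, r) : V * R^o)].
have regE (a s : R) : a *: (s : R^o) = a * s by [].
split; [split| |].
- move=> a _ _ [u1 [a1 [Gu1 ->]]] [u2 [a2 [Gu2 ->]]].
  exists (a *: u1 + u2), (a * a1 + a2); split; first exact: Glin.
  by rewrite scalerDr scalerDl scalerA addrACA.
- move=> _ [u [a [Gu ->]]] /=.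
  have [a0|a0|->] := ltgtP a 0; last by rewrite !scale0r !addr0; exact: Gp.
  (* The sign of [a] selects the bound on [r]: the lower one for [a < 0], the upper one for [a > 0].
     It is taken at [u] divided by the absolute value of [a], then scaled back. *)
  + have b0 : 0 < - a by rewrite oppr_gt0.
    have /= := r_ge _ (GZ (- a)^-1 _ Gu).
    rewrite -(ler_pM2l b0) mulrBr -pZ// scalerBr scalerA.
    rewrite divff ?gt_eqF// scale1r !regE mulVKf ?gt_eqF// scaleNr opprK mulNr.
    by rewrite lerBlDr addrC -lerBlDr opprK addrC.
  + have /= := r_le _ (GZ a^-1 _ Gu).
    rewrite -(ler_pM2l a0) mulrBr -pZ// scalerDr scalerA.
    rewrite divff ?gt_eqF// scale1r !regE mulVKf ?gt_eqF//.
    by rewrite lerBrDr addrC.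
- by move=> u Gu; exists u, 0; rewrite scale0r addr0.
- by exists r, 0, 1; rewrite scale1r add0r.
Qed.

(** A maximal graph from Zorn's lemma is total: an extension to [v] that is not contained in it
    would be strictly larger. *)
Lemma dominated_linear_graph_maximal G0 :
  G0 0 -> dominated_linear_graph G0 ->
  exists G, [/\ dominated_linear_graph G, G0 `<=` G &
    forall v, exists r, G (v, r)].
Proof.
move=> G00 dG0.
(* The empty chain forces the union with [G0]. *)
pose P G := dominated_linear_graph (G0 `|` G).
have [F FP Ftot|G [PG Gmax]] := @Zorn_bigcup _ P.
  split=> [a u v Gu Gv|u [/dG0.2//|[K FK Ku]]]; last first.
    by apply: (FP _ FK).2; right.
  have in_one K : F K -> (G0 `|` K) u -> (G0 `|` K) v ->
      (G0 `|` \bigcup_(K in F) K) (a *: u + v).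
    move=> FK Ku Kv; have [] := (FP _ FK).1 a _ _ Ku Kv; first by left.
    by right; exists K.
  case: Gu Gv => [Gu|[K FK Ku]] [Gv|[L FL Lv]].
  - by left; exact: dG0.1.
  - by apply: (in_one _ FL); [left|right].
  - by apply: (in_one _ FK); [right|left].
  - have [KL|LK] := Ftot _ _ FK FL.
    + by apply: (in_one _ FL); right => //; exact: KL.
    + by apply: (in_one _ FK); right => //; exact: LK.
exists (G0 `|` G); split=> // v.
have [|G' [dG' GG' [r G'r]]] := dominated_linear_graph_extend v _ PG.
  by left.
exists r; have [G'G|G'G] := pselect (G' `<=` G); first by right; exact: G'G.
exfalso; apply: (Gmax G').
  by split=> // u Gu; apply: GG'; right.
by rewrite /P setUidr// => u G0u; apply: GG'; left.
Qed.

(** The pairs [(i w, f w)] form a dominated graph. A total dominated graph containing them is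
    single-valued, which makes the chosen [g] linear and equal to [f] along [i]. *)
Lemma hahn_banach (W : lmodType R) (i : {linear W -> V})
    (f : {linear W -> R^o}) : (forall w, f w <= p (i w)) ->
  exists g : {linear V -> R^o}, (forall w, g (i w) = f w) /\
    (forall x, g x <= p x).
Proof.
move=> fp.
have [||G [dG iG Gtot]] := @dominated_linear_graph_maximal
    [set ((i w, f w) : V * R^o) | w in setT].
- by exists 0 => //; rewrite !linear0.
- split=> [a _ _ [u _ <-] [v _ <-]|_ [w _ <-]] /=; last exact: fp.
  by exists (a *: u + v) => //; rewrite !linearP.
have [g Gg] := choice Gtot.
have g_lin : linear (g : V -> R^o).
  move=> a x y; apply: (dominated_linear_graph_fun dG (Gg _)).
  exact: (dG.1 _ _ _ (Gg x) (Gg y)).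
pose gL := GRing.isLinear.Build R V R^o *:%R g g_lin.
pose gF : {linear V -> R^o} := HB.pack g gL.
exists gF; split=> [w|x] /=; last exact: (dG.2 (x, _)).
by apply: (dominated_linear_graph_fun dG (Gg _)); apply: iG; exists w.
Qed.

End HahnBanach.

(** A bound [C] for [f] gives the sublinear majorant [C * |x|]. Domination at both [x] and [- x]
    then bounds the absolute value of [g x]. *)
Lemma hahn_banach_isometry {R : realType} (V W : normedModType R)
    (i : {linear W -> V}) (f : {linear W -> R^o}) :
  (forall w, `|i w| = `|w|) -> continuous f ->
  exists2 g : {linear V -> R^o}, continuous g & forall w, g (i w) = f w.
Proof.
move=> i_isom /linear_bounded_continuous/linear_boundedP.
move=> /pinfty_ex_gt0[C C0 fC].
have [||w|g [gi gC]] := @hahn_banach R V (fun x => C * `|x|) _ _ W i f.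
- by move=> x y; rewrite -mulrDr ler_wpM2l ?ler_normD// ltW.
- by move=> a x a0; rewrite normrZ gtr0_norm// mulrCA.
- by rewrite i_isom; apply: le_trans (fC w); exact: ler_norm.
exists g => //; apply/linear_bounded_continuous/linear_boundedP.
exists C; split; first exact: gtr0_real.
move=> r Cr x; apply: (@le_trans _ _ (C * `|x|)).
  by rewrite ler_norml gC andbT lerNl -linearN -[`|x|]normrN.
by rewrite ler_wpM2r// ltW.
Qed.

(** * Norm limits and weakly null sequences *)

Lemma cvg_norm_sub0 {K : numFieldType} {V : normedModType K} (u v : V^nat)
    (l : K) :
  u n - v n @[n --> \oo] --> (0 : V) -> `|v n| @[n --> \oo] --> l ->
  `|u n| @[n --> \oo] --> l.
Proof.
move=> uv; apply: (@cvg_sub0 K K^o).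
apply/cvgr0Pnorm_lt => e e0; near=> n.
rewrite /= fctE; apply: le_lt_trans (ler_dist_dist _ _) _.
by near: n; move/cvgr0Pnorm_lt : uv; exact.
Unshelve. all: by end_near. Qed.

(* Interleaving [u] with [0] identifies the norm limit of [u] without
   separating points by functionals. *)
Lemma schur_weakly_null {R : realType} {V : normedModType R} (u : V^nat) :
  schur_property V -> weakly_cvg u 0 -> u @ \oo --> (0 : V).
Proof.
move=> schurV u0.
have half_oo : n./2 @[n --> \oo] --> \oo.
  apply/cvgnyPge => N; near=> n.
  by rewrite -(doubleK N) half_leq//; near: n; exact: nbhs_infty_ge.
have double_oo : n.*2 @[n --> \oo] --> \oo.
  apply/cvgnyPge => N; near=> n.
  rewrite (@leq_trans n)// -?addnn ?leq_addr//.
  by near: n; exact: nbhs_infty_ge.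
have doubleS_oo : n.*2.+1 @[n --> \oo] --> \oo.
  apply/cvgnyPge => N; near=> n.
  rewrite (@leq_trans n)// -?addnn -?addnS ?leq_addr//.
  by near: n; exact: nbhs_infty_ge.
pose v n := if odd n then 0 else u n./2.
have /schurV/cvg_ex[/= l vl] : exists l, weakly_cvg v l.
  exists 0 => f fc; have := u0 f fc; rewrite !linear0 => fu0.
  have fuh : f (u n./2) @[n --> \oo] --> (0 : R^o).
    exact: cvg_comp half_oo fu0.
  apply/cvgr0Pnorm_lt => e e0; near=> n; rewrite /v; case: ifP => _.
    by rewrite linear0 normr0.
  by near: n; move/cvgr0Pnorm_lt : fuh; exact.
have l0 : l = 0.
  have v0 : v n.*2.+1 @[n --> \oo] --> (0 : V).
    rewrite (_ : (fun n => _) = cst 0); first exact: cvg_cst.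
    by apply/funext => n; rewrite /v /= odd_double.
  by apply: cvg_unique v0 => //; exact: cvg_comp doubleS_oo vl.
rewrite -l0 (_ : u = fun n => v n.*2); first exact: cvg_comp double_oo vl.
by apply/funext => n; rewrite /v odd_double doubleK.
Unshelve. all: by end_near. Qed.

(** * Lifting from the quotient and normalizing *)

Lemma continuous_quot_proj {R : realType} {X : normedModType R}
  (Y : closedSubspace X) : continuous (quot_proj Y).
Proof.
apply: bounded_linear_continuous; apply/linear_boundedP.
exists 1; split=> [|r r1 x]; first exact: real1.
apply: (le_trans (quot_norm_le Y x)).
by rewrite ler_peMl// ltW.
Qed.

Lemma weakly_cvg_comp {R : realType} (V W : normedModType R)
    (g : {linear V -> W}) (u : V^nat) l :
  continuous g -> weakly_cvg u l -> weakly_cvg (g \o u) (g l).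
Proof.
move=> gc ul f fc; apply: (ul (f \o g)%FUN) => x.
exact: continuous_comp (gc _) (fc _).
Qed.

Lemma dist_quot_cvg0 {R : realType} {X : normedModType R}
    (Y : closedSubspace X) (y : X^nat) :
  quot_proj Y (y n) @[n --> \oo] --> (0 : quot_space Y) ->
  exists2 w : X^nat, w @ \oo --> (0 : X) & forall n, y n - w n \in Y.
Proof.
move=> qy0.
(* The quotient norm is an infimum that may not be attained; the slack [harmonic n] secures a
   representative and still tends to 0. *)
have /choice[w wP] n : exists x, quot_proj Y x = quot_proj Y (y n) /\
    `|x| < `|quot_proj Y (y n)| + harmonic n.
  have [|x xy xlt] := @quot_norm_lt _ _ Y (quot_proj Y (y n))
    (`|quot_proj Y (y n)| + harmonic n); last by exists x.
  by rewrite ltrDl harmonic_gt0.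
exists w => [|n]; last by apply/quot_projP; rewrite (wP n).1.
apply/norm_cvg0P.
apply: (@squeeze_cvgr _ _ _ _ (cst 0)
  (fun n => `|quot_proj Y (y n)| + harmonic n)).
- by near=> n; rewrite normr_ge0 ltW// (wP n).2.
- exact: cvg_cst.
- rewrite -[X in _ --> X]addr0; apply: cvgD; last exact: cvg_harmonic.
  by apply/norm_cvg0P.
Unshelve. all: by end_near. Qed.

(** The factor comes from [|y - w| <= 1 + |w|]. Since [t - y = - (|w| *: t) - w] and [|t| <= 1], the
    error is at most [2 * |w|]. *)
Lemma le_norm_normalize {R : realType} {V : normedModType R} (y w : V) :
  `|y| <= 1 -> let t := (1 + `|w|)^-1 *: (y - w) in
  `|t| <= 1 /\ `|t - y| <= 2 * `|w|.
Proof.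
move=> y1 /=.
have w1 : 0 < 1 + `|w| by rewrite ltr_pwDl.
have yw : `|y - w| <= 1 + `|w|.
  by rewrite (le_trans (ler_normB _ _))// lerD2r.
have t1 : `|(1 + `|w|)^-1 *: (y - w)| <= 1.
  by rewrite normrZ gtr0_norm ?invr_gt0// mulrC ler_pdivrMr// mul1r.
split=> //.
set t := _ *: _ in t1 *.
have -> : t - y = - (`|w| *: t) - w.
  have yt : y - w = (1 + `|w|) *: t.
    by rewrite /t scalerA mulfV ?scale1r ?gt_eqF.
  rewrite -[y in LHS](subrK w) yt scalerDl scale1r.
  by rewrite -addrA opprD addrA opprD addrA subrr add0r.
rewrite (le_trans (ler_normB _ _))// normrN normrZ normr_id mulr_natl mulr2n.
by rewrite lerD2r ler_piMr.
Qed.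

Theorem theorem3p7 (R : realType) (X : completeNormedModType R)
    (Y : closedSubspace X)
    (Y_neq0 : exists2 y : X, y \in Y & y != 0)
    (X_wasq : WASQ X)
    (XY_schur : schur_property (quot_space Y)) :
  WASQ (sub_space Y).
Proof.
move=> x x1.
have [y [y1 [xDy xBy] ny y0]] := X_wasq (val x) x1.
have qy0 : quot_proj Y (y n) @[n --> \oo] --> (0 : quot_space Y).
  apply: (@schur_weakly_null _ _ (fun n => quot_proj Y (y n))) => //.
  have := weakly_cvg_comp (@continuous_quot_proj _ _ Y) y0.
  by rewrite linear0.
have [w w0 ywY] := dist_quot_cvg0 qy0.
pose t n : sub_space Y := (1 + `|w n|)^-1 *: SubSpace (ywY n).
have tE n : val (t n) = (1 + `|w n|)^-1 *: (y n - w n) by rewrite linearZ.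
have ty0 : val (t n) - y n @[n --> \oo] --> (0 : X).
  apply/norm_cvg0P; apply: (@squeeze_cvgr _ _ _ _ (cst 0)
    (fun n => 2 * `|w n|)).
  - by near=> n; rewrite normr_ge0 andTb tE (le_norm_normalize _ (y1 n)).2.
  - exact: cvg_cst.
  - rewrite -[X in _ --> X](mulr0 2); apply: cvgM; first exact: cvg_cst.
    exact/norm_cvg0P.
exists t; split.
- by move=> n; rewrite sub_normE tE (le_norm_normalize _ (y1 n)).1.
- split.
  + apply: (@cvg_norm_sub0 _ _ (fun n => val x + val (t n)) _ _ _ xDy).
    rewrite (_ : (fun n => _) = fun n => val (t n) - y n)//.
    by apply/funext => n; rewrite opprD addrACA subrr add0r.
  + apply: (@cvg_norm_sub0 _ _ (fun n => val x - val (t n)) _ _ _ xBy).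
    rewrite (_ : (fun n => _) = fun n => - (val (t n) - y n)).
      by rewrite -oppr0; exact: cvgN.
    by apply/funext => n; rewrite [in LHS]opprD addrACA subrr add0r opprD.
- exact: (@cvg_norm_sub0 _ _ (fun n => val (t n)) _ _ ty0 ny).
- move=> f fc.
  have [g gc gf] := @hahn_banach_isometry R X (sub_space Y) val f
    (fun=> erefl) fc.
  have gy0 := y0 g gc.
  rewrite linear0; rewrite linear0 in gy0.
  have gty : g (val (t n) - y n) @[n --> \oo] --> (0 : R^o).
    by rewrite -(linear0 g); exact: cvg_comp ty0 (gc 0).
  (* The first summand vanishes in the limit by continuity of [g], the second by weak nullity of
     [y]. *)
  rewrite (_ : (fun n => _) = fun n => g (val (t n) - y n) + g (y n)).
    by rewrite -[X in _ --> X]addr0; exact: cvgD.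
  by apply/funext => n; rewrite -gf -linearD subrK.
Unshelve. all: by end_near. Qed.
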